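(* Every positive rational number $q$ has an Egyptian fraction representation in which all denominators are practical numbers, an Egyptian fraction representation in which all denominators are odious numbers, and an Egyptian fraction representation in which all denominators are evil numbers. That is, for each of the three sets $S$ (the positive practical numbers, the positive odious numbers, the positive evil numbers) and every rational $q>0$ there is a finite subset $D\subseteq S$ with $q=\sum_{d\in D}\frac{1}{d}$.
   Context: An \emph{Egyptian fraction} is a representation of a rational number as a finite sum of distinct unit fractions $1/d$ with $d$ a positive integer; the unit fraction $1/1$ is allowed. A positive integer $n$ is \emph{practical} if every positive integer $m\le n$ can be represented as a sum of distinct (positive) divisors of $n$. A positive integer is \emph{odious} if its binary representation has an odd number of nonzero bits, and \emph{evil} if its binary representation has an even number of nonzero bits. *)

(* Defs.v *)
From mathcomp Require Import all_boot all_order all_algebra finmap.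

Set Implicit Arguments.
Unset Strict Implicit.
Unset Printing Implicit Defensive.

Import Order.TTheory GRing.Theory Num.Theory.

(* As n > 0, a d with d %| n is automatically positive. *)
Definition practical (n : nat) : Prop :=
  (0 < n)%N /\
  forall m : nat, (0 < m)%N -> (m <= n)%N ->
    exists D : {fset nat},
      (forall d : nat, d \in D -> (d %| n)%N) /\
      m = (\sum_(d <- D) d)%N.

Definition bit (n i : nat) : bool := odd (n %/ 2 ^ i).

(* Positions i < n suffice since n < 2 ^ n: see bit_geq and binary_expansion. *)
Definition bit_count (n : nat) : nat := #|[set i : 'I_n | bit n i]|.

Lemma bit_geq (n i : nat) : (n <= i)%N -> bit n i = false.
Proof.
move=> le_ni; rewrite /bit divn_small //.
by apply: leq_ltn_trans le_ni _; apply: ltn_expl.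
Qed.

Lemma binary_expansion (n : nat) : n = (\sum_(i < n) bit n i * 2 ^ i)%N.
Proof.
suff E k : n = (\sum_(i < k) bit n i * 2 ^ i + n %/ 2 ^ k * 2 ^ k)%N.
  by rewrite [LHS](E n) [X in (_ + X * _)%N]divn_small ?addn0 // ltn_expl.
elim: k => [|k IHk]; first by rewrite big_ord0 expn0 divn1 muln1.
rewrite big_ord_recr /= -addnA {1}IHk /bit; congr (_ + _)%N.
rewrite expnSr divnMA divn2 [(2 ^ k * 2)%N]mulnC mulnA muln2 -mulnDl.
by rewrite odd_double_half.
Qed.

Definition odious (n : nat) : Prop := (0 < n)%N /\ odd (bit_count n).

Definition evil (n : nat) : Prop := (0 < n)%N /\ ~~ odd (bit_count n).

Definition egyptian_in (S : nat -> Prop) (q : rat) : Prop :=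
  exists D : {fset nat},
    (forall d : nat, d \in D -> (0 < d)%N /\ S d) /\
    q = (\sum_(d <- D) d%:R^-1)%R.

(* Main.v *)
Require Import Defs.
From mathcomp Require Import all_boot all_order all_algebra finmap.
From mathcomp Require Import boolp reals sequences exp Rstruct.
From mathcomp Require Import zify ring lra.
(** Let S be closed under doubling and let d_1, ..., d_k be odd multiples of an
    odd b with 2^t d_i in S. Sums of distinct 1 / (2^j d_i), j >= t, produce all
    x / (2^J d_i) with x <= 2^(J-t); choosing x divisible by d_i / b gives the
    multiples of 1 / (2^J b) up to about 2^-t / d_i. So every c / (2^e b) is
    reached as soon as the sum of the 1/d_i is large, and it suffices that such
    sums are unbounded for every odd b.

    Odious and evil numbers: b (2^k - 1) has exactly k binary digits 1 when
    b <= 2^k, so every multiple of b, shifted to the left, can be completed by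
    an odd multiple of b of prescribed digit parity.

    Practical numbers: if N is practical, so is N p_1 ... p_r whenever the p_i
    are increasing primes not dividing N with p_(i+1) <= N p_1 ... p_i. Suppose
    that the sum of 1/n over these n = p_1 ... p_r converges. Draw a random set
    of primes, each p with probability a_p / (1 + a_p), where a_p is close to
    1/p, and read it in increasing order until the first prime exceeding N n,
    n being the product of the chosen primes. The process
    log n - (sum over primes p read of log p times the probability of p) is
    a martingale with mean 0. By Mertens' estimate it is below -1 when the
    reading stops, provided N is large; the contribution of large n, and of
    the sets for which the reading has not stopped, is O(1/n) for each n, hence
    arbitrarily small. This contradicts mean 0. *)

Set Implicit Arguments.
Unset Strict Implicit.
Unset Printing Implicit Defensive.
Import Order.TTheory GRing.Theory Num.Theory.
Local Open Scope ring_scope.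

(** * Denominators with unbounded reciprocal sums *)

Lemma egyptian_in_seq (S : nat -> Prop) (s : seq nat) :
    uniq s -> (forall d, d \in s -> (0 < d)%N /\ S d) ->
  egyptian_in S (\sum_(d <- s) d%:R^-1).
Proof.
move=> us Ss; exists [fset d in s]%fset; split=> [d|]; first by rewrite inE; apply: Ss.
apply: perm_big; apply: uniq_perm => // [|d]; first exact: fset_uniq.
by rewrite inE.
Qed.

Lemma sum_pow2 (u x : nat) : (x < 2 ^ u)%N ->
  exists I : seq nat, [/\ uniq I, all (fun i => i < u)%N I & x = (\sum_(i <- I) 2 ^ i)%N].
Proof.
elim: u x => [|u IHu] x xu; first by exists [::]; rewrite big_nil; split=> //; move: xu; case: x.
have [lt_xu|le_ux] := ltnP x (2 ^ u).
  have [I [uI Iu ->]] := IHu _ lt_xu; exists I; split=> //.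
  by apply: sub_all Iu => i; apply: leqW.
have [|I [uI Iu xE]] := IHu (x - 2 ^ u)%N; first by move: xu; rewrite expnS; lia.
exists (u :: I); split=> /=.
- by rewrite uI andbT; apply/negP => /(allP Iu); rewrite ltnn.
- by rewrite leqnn; apply: sub_all Iu => i; apply: leqW.
- by rewrite big_cons -xE subnKC.
Qed.

Lemma odd_pow2_inj (i j d e : nat) : odd d -> odd e -> (2 ^ i * d = 2 ^ j * e -> d = e)%N.
Proof.
move=> od oe /(congr1 (fun n => n`_2^')%N).
have odd2' n : odd n -> (n`_2^' = n)%N.
  by move=> on; apply: part_pnat_id; rewrite -odd_2'nat.
have pow2' n : ((2 ^ n)`_2^' = 1)%N.
  by apply: part_p'nat; rewrite pnatNK pnatX pnat_id.
by rewrite !partnM ?expn_gt0 ?(odd_gt0 od) ?(odd_gt0 oe) // !pow2' !mul1n !odd2'.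
Qed.

(** Each [d = r * b] in [E] absorbs a numerator [y] up to [2 ^ h %/ r]: since [y * r <= 2 ^ h], the
    binary digits of [y * r] turn [y / (2 ^ (t + h) * b)] into a sum of distinct
    [1 / (2 ^ (t + h - i) * d)]. Different [d] cannot collide, being the odd parts of the
    denominators. *)
Lemma dyadic_sum (b t h : nat) (E : seq nat) (T : nat) :
    uniq E -> (0 < b)%N -> (forall d, d \in E -> odd d /\ (b %| d)%N) ->
    (T <= \sum_(d <- E) 2 ^ h %/ (d %/ b))%N ->
  exists s : seq nat, [/\ uniq s,
    forall n, n \in s -> exists i d, [/\ (t <= i)%N, d \in E & n = (2 ^ i * d)%N] &
    (\sum_(n <- s) n%:R^-1 = T%:R / (2 ^ (t + h) * b)%:R :> rat)].
Proof.
move=> + b0; elim: E T => [|d E IHE] T /=.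
  move=> _ _; rewrite big_nil leqn0 => /eqP->; exists [::].
  by split=> //; rewrite big_nil mul0r.
move=> /andP[dE uE] Eb; rewrite big_cons => leT.
have [od bd] := Eb d (mem_head _ _).
set r := (d %/ b)%N in leT; have dr : d = (r * b)%N by rewrite divnK.
have d0 : (0 < d)%N := odd_gt0 od.
have r0 : (0 < r)%N by move: d0; rewrite dr muln_gt0 => /andP[].
pose y := minn T (2 ^ h %/ r).
have [||s [us sP sE]] := IHE (T - y)%N uE.
- by move=> e eE; apply: Eb; rewrite inE eE orbT.
- by rewrite /y; lia.
(* [y * r] may equal [2 ^ h], so [i = h] has to be allowed; it gives the smallest shift, [t]. *)
have [I [uI Iu xE]] : exists I : seq nat, [/\ uniq I, all (fun i => i < h.+1)%N I &
    (y * r = \sum_(i <- I) 2 ^ i)%N].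
  apply: sum_pow2; rewrite (@leq_ltn_trans (2 ^ h)) ?ltn_exp2l //.
  by rewrite (leq_trans _ (leq_trunc_div (2 ^ h) r)) // leq_mul2r geq_minr orbT.
exists ([seq (2 ^ (t + h - i) * d)%N | i <- I] ++ s); split.
- rewrite cat_uniq us andbT map_inj_in_uniq ?uI /=.
    apply/hasPn => n /sP[i [e [_ eE ->]]]; apply/mapP => -[j _ /odd_pow2_inj eqed].
    case/negP: dE; rewrite -eqed //.
    by have [] := Eb e; rewrite // inE eE orbT.
  move=> i j /(allP Iu) iu /(allP Iu) ju /eqP.
  rewrite eqn_mul2r (gtn_eqF d0) /= eqn_exp2l // => /eqP; move: iu ju; rewrite /=; lia.
- move=> n; rewrite mem_cat => /orP[/mapP[i /(allP Iu)/= iu ->]|/sP[i [e [ti eE ->]]]].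
    by exists (t + h - i)%N, d; rewrite mem_head; split=> //; move: iu; lia.
  by exists i, e; rewrite inE eE orbT.
rewrite big_cat sE big_map /= natrB ?geq_minl // mulrBl.
suff -> : \sum_(i <- I) (2 ^ (t + h - i) * d)%:R^-1 = y%:R / (2 ^ (t + h) * b)%:R :> rat by ring.
have rn0 : r%:R != 0 :> rat by rewrite pnatr_eq0 -lt0n.
have bn0 : b%:R != 0 :> rat by rewrite pnatr_eq0 -lt0n.
transitivity ((y * r)%:R / (2 ^ (t + h) * d)%:R :> rat); last first.
  rewrite dr !natrM; field.
  by rewrite rn0 bn0 pnatr_eq0 expn_eq0.
rewrite xE natr_sum mulr_suml; apply: eq_big_seq => i /(allP Iu) iu.
have -> : (2 ^ (t + h) = 2 ^ i * 2 ^ (t + h - i))%N.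
  by rewrite -expnD; congr (_ ^ _)%N; move: iu => /=; lia.
have dn0 : d%:R != 0 :> rat by rewrite pnatr_eq0 -lt0n.
rewrite !natrM; field.
by rewrite dn0 !pnatr_eq0 !expn_eq0.
Qed.

Lemma egyptian_in_of_divergent (S : nat -> Prop) (q : rat) : 0 < q ->
    (forall n, S n -> S (2 * n)%N) ->
    (forall b, odd b -> exists t, forall C : nat, exists E : seq nat, [/\ uniq E,
       forall d, d \in E -> [/\ odd d, (b %| d)%N & S (2 ^ t * d)%N] &
       C%:R <= \sum_(d <- E) d%:R^-1 :> rat]) ->
  egyptian_in S q.
Proof.
move=> q0 S2 Sdiv.
have S2X i n : S n -> S (2 ^ i * n)%N.
  by move=> Sn; elim: i => [|i IHi]; rewrite ?mul1n // expnS -mulnA; apply: S2.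
pose den := `|denq q|%N; pose c := `|numq q|%N.
have den0 : (0 < den)%N by rewrite absz_gt0 denq_eq0.
have qE : q = c%:R / den%:R.
  by rewrite -[LHS]divq_num_den !pmulrn !gez0_abs ?denq_ge0 ?numq_ge0 ?(ltW q0).
pose e := logn 2 den; pose b := (den`_2^')%N.
have denE : den = (2 ^ e * b)%N by rewrite -p_part partnC.
have ob : odd b by rewrite odd_2'nat part_pnat.
have b0 := odd_gt0 ob.
have [t /(_ (c * 2 ^ t).+1)[E [uE Eb leE]]] := Sdiv b ob.
(* Rounding [2 ^ h %/ (d %/ b)] down costs at most 1 per member of [E]; the [.+1] above leaves a
   surplus of at least [2 ^ h > size E]. The summand [e] keeps [h - e] from being truncated. *)
pose h := (size E + e)%N.
have [||s [us sP sE]] := @dyadic_sum b t h E (c * 2 ^ (t + (h - e))) uE b0.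
- by move=> d /Eb[].
- rewrite -(ler_nat rat) natr_sum.
  have le_floor d : d \in E -> 2 ^+ h * b%:R * d%:R^-1 - 1 <= (2 ^ h %/ (d %/ b))%:R :> rat.
    move=> /Eb[od bd _]; set r := (d %/ b)%N.
    have dr : d = (r * b)%N by rewrite divnK.
    have r0 : (0 < r)%N by move: (odd_gt0 od); rewrite dr muln_gt0 => /andP[].
    rewrite dr natrM invfM [_ * (_ * _)]mulrACA mulfV ?pnatr_eq0 -?lt0n // mulr1.
    rewrite lerBlDr natr1 ler_pdivrMr ?ltr0n // -natrX -natrM ler_nat.
    by rewrite ltnW // ltn_ceil.
  apply: (@le_trans _ _ (\sum_(d <- E) (2 ^+ h * b%:R * d%:R^-1 - 1))); last first.
    by rewrite big_seq [leRHS]big_seq; apply: ler_sum.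
  rewrite sumrB -mulr_sumr big_const_seq count_predT iter_addr_0.
  apply: (@le_trans _ _ (2 ^+ h * (c * 2 ^ t).+1%:R - (size E)%:R)); last first.
    rewrite lerD2r // -mulrA ler_wpM2l ?exprn_ge0 // (le_trans leE) //.
    by rewrite ler_peMl ?ler1n // sumr_ge0 // => d _; rewrite invr_ge0.
  rewrite lerBrDr -natrX -natrM -natrD ler_nat mulnS expnD.
  have : (2 ^ (h - e) <= 2 ^ h)%N by rewrite leq_exp2l // leq_subr.
  have : (size E < 2 ^ (size E))%N by apply: ltn_expl.
  have : (2 ^ size E <= 2 ^ h)%N by rewrite leq_exp2l // leq_addr.
  nia.
suff -> : q = \sum_(n <- s) n%:R^-1.
  apply: egyptian_in_seq => // n /sP[i [d [ti dE ->]]].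
  have [od _ Sd] := Eb d dE; split; first by rewrite muln_gt0 expn_gt0 (odd_gt0 od).
  by rewrite -(subnK ti) expnD -mulnA; apply: S2X.
rewrite sE (_ : t + (h - e) = t + h - e)%N; last by rewrite /h; lia.
rewrite qE denE -[in RHS](@subnK e (t + h)) 1?expnD; last by rewrite /h; lia.
rewrite addnK !natrM; field.
by rewrite !pnatr_eq0 !expn_eq0 -lt0n b0.
Qed.

(** * Binary digits *)

Lemma bit_count_sum (n k : nat) : (n <= k)%N -> bit_count n = (\sum_(0 <= i < k) bit n i)%N.
Proof.
move=> le_nk; rewrite (@big_cat_nat _ _ _ n)//=.
rewrite [X in (_ + X)%N]big1_seq ?addn0 => [|i]; last first.
  by rewrite mem_index_iota => /andP[_ /andP[ni _]]; rewrite bit_geq.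
rewrite big_mkord /bit_count -sum1_card big_mkcond /=.
by apply: eq_bigr => i _; rewrite inE; case: (bit n i).
Qed.

Lemma bit_count_double (n : nat) (c : bool) : bit_count (c + n.*2) = (c + bit_count n)%N.
Proof.
rewrite (@bit_count_sum _ (c + n.*2).+1) // big_nat_recl // (@bit_count_sum n (c + n.*2)).
  congr (_ + _)%N; first by rewrite /bit divn1 oddD odd_double addbF; case: c.
  by apply: eq_bigr => i _; rewrite /bit expnS divnMA divn2 half_bit_double.
by rewrite -addnn; lia.
Qed.

Lemma bit_count0 : bit_count 0 = 0%N.
Proof. by rewrite (@bit_count_sum 0 0) // big_geq. Qed.

Lemma bit_count_shift (k x y : nat) : (x < 2 ^ k)%N ->
  bit_count (2 ^ k * y + x) = (bit_count y + bit_count x)%N.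
Proof.
elim: k x => [|k IHk] x.
  by rewrite expn0 ltnS leqn0 => /eqP->; rewrite mul1n bit_count0 !addn0.
rewrite -{1 2 3}(odd_double_half x) expnS => xk.
have -> : (2 * 2 ^ k * y + (odd x + x./2.*2) = odd x + (2 ^ k * y + x./2).*2)%N.
  by rewrite -!muln2; ring.
have lt_half : (x./2 < 2 ^ k)%N by move: xk; lia.
by rewrite (bit_count_double (2 ^ k * y + x./2)) (bit_count_double x./2) IHk // addnCA.
Qed.

Lemma bit_count_compl (k x : nat) : (x < 2 ^ k)%N ->
  (bit_count (2 ^ k - 1 - x) + bit_count x = k)%N.
Proof.
elim: k x => [|k IHk] x.
  by rewrite expn0 ltnS leqn0 => /eqP->; rewrite bit_count0.
rewrite -{1 2 3}(odd_double_half x) expnS => xk.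
have -> : (2 * 2 ^ k - 1 - (odd x + x./2.*2) = ~~ odd x + (2 ^ k - 1 - x./2).*2)%N.
  by move: xk; case: (odd x) => /=; lia.
have lt_half : (x./2 < 2 ^ k)%N by move: xk; lia.
rewrite (bit_count_double (2 ^ k - 1 - x./2)) (bit_count_double x./2) addnACA IHk //.
by case: (odd x).
Qed.

(* b (2^k - 1) = 2^k (b - 1) + (2^k - 1 - (b - 1)): complementary digit blocks. *)
Lemma bit_count_mul_pred_pow2 (k b : nat) : (0 < b <= 2 ^ k)%N ->
  bit_count (b * (2 ^ k - 1)) = k.
Proof.
move=> /andP[b0 bk].
have -> : (b * (2 ^ k - 1) = 2 ^ k * b.-1 + (2 ^ k - 1 - b.-1))%N by case: b b0 bk => //=; nia.
by rewrite bit_count_shift 1?addnC ?bit_count_compl //; move: b0 bk; lia.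
Qed.

Lemma harmonic_unbounded (C : nat) : exists n, C%:R <= \sum_(1 <= i < n.+1) i%:R^-1 :> rat.
Proof.
suff H k : k%:R / 2 <= \sum_(1 <= i < (2 ^ k).+1) i%:R^-1 :> rat.
  by exists (2 ^ (C * 2))%N; apply: le_trans (H _); rewrite natrM mulfK.
elim: k => [|k IHk]; first by rewrite mul0r sumr_ge0 // => i _; rewrite invr_ge0.
rewrite (@big_cat_nat _ _ _ (2 ^ k).+1) //= ?ltnS ?leq_exp2l //.
rewrite -natr1 mulrDl; apply: lerD => //.
apply: (@le_trans _ _ (\sum_((2 ^ k).+1 <= i < (2 ^ k.+1).+1) (2 ^ k.+1)%:R^-1)).
  rewrite sumr_const_nat expnS subSS mul2n -addnn addnK -mulr_natl addnn -mul2n natrM.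
  rewrite le_eqVlt; apply/orP; left; apply/eqP; field.
  by rewrite pnatr_eq0 expn_eq0.
apply: ler_sum_nat => i /andP[ki ik].
by rewrite lef_pV2 ?ler_nat // posrE ltr0n ?expn_gt0 //; apply: leq_ltn_trans ki.
Qed.

(** Odious for [s = true], evil for [s = false]: one argument serves both. *)
Definition bit_parity (s : bool) (n : nat) : Prop := (0 < n)%N /\ odd (bit_count n) = s.

Lemma bit_parity_double (s : bool) (n : nat) : bit_parity s n -> bit_parity s (2 * n).
Proof.
move=> [n0 ns]; split; first by rewrite muln_gt0.
by rewrite mul2n (bit_count_double n false).
Qed.

(** To the binary digits of [b * y] a block of [K] low digits is appended, holding an odd multiple
    of [b] of the digit parity required. The result is at most [2 ^ K * (2 * b) * y], so the
    reciprocals dominate a fixed multiple of the harmonic series. *)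
Lemma bit_parity_divergent (s : bool) (b : nat) : odd b ->
  forall C : nat, exists E : seq nat, [/\ uniq E,
    forall d, d \in E -> [/\ odd d, (b %| d)%N & bit_parity s (2 ^ 0 * d)] &
    C%:R <= \sum_(d <- E) d%:R^-1 :> rat].
Proof.
move=> ob C; have b0 := odd_gt0 ob.
(* The exponent is positive, of parity [e], and large enough for [bit_count_mul_pred_pow2]; so [c e]
   is odd with digit parity [e]. *)
pose c (e : bool) := let k := (b.*2 + e)%N in (b * (2 ^ k - 1))%N.
have bk (e : bool) : (b < 2 ^ (b.*2 + e))%N.
  by apply: leq_trans (ltn_expl b (isT : 1 < 2)%N) _; rewrite leq_exp2l //; lia.
have odd_bit_c e : odd (bit_count (c e)) = e.
  by rewrite bit_count_mul_pred_pow2 ?b0 ?(ltnW (bk e)) // oddD odd_double; case: e.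
have odd_c e : odd (c e).
  by rewrite /c oddM ob oddB ?expn_gt0 // oddX orbF addn_eq0 double_eq0 (gtn_eqF b0).
pose K := (c false + c true)%N.
have K0 : (0 < K)%N by rewrite addn_gt0 !odd_gt0.
have cK e : (c e < 2 ^ K)%N.
  by apply: leq_ltn_trans (ltn_expl K (isT : 1 < 2)%N); rewrite /K; case: e; lia.
pose m y := (2 ^ K * (b * y) + c (odd (bit_count (b * y)) != s))%N.
have m_lt y : (m y < 2 ^ K * (b * y).+1)%N.
  by rewrite /m mulnS [X in (_ < X)%N]addnC ltn_add2l.
have [n len] := harmonic_unbounded (2 ^ K * (2 * b) * C).
exists [seq m y | y <- index_iota 1 n.+1]; split.
- rewrite map_inj_uniq ?iota_uniq // => y y' /(congr1 (fun x => x %/ 2 ^ K)%N).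
  rewrite /m ![(2 ^ K * _)%N]mulnC !divnMDl ?expn_gt0 // !divn_small // !addn0.
  by move/eqP; rewrite eqn_pmul2l // => /eqP.
- move=> d /mapP[y]; rewrite mem_index_iota => /andP[y0 _] ->; rewrite mul1n; split.
  + by rewrite /m oddD odd_c oddM oddX orbF (gtn_eqF K0).
  + by apply: dvdn_add; [apply: dvdn_mull|]; apply: dvdn_mulr.
  + split; first by rewrite addn_gt0 muln_gt0 expn_gt0 muln_gt0 b0 y0.
    by rewrite bit_count_shift // oddD odd_bit_c; case: (odd _) (s) => [] [].
rewrite big_map; apply: (@le_trans _ _ ((2 ^ K * (2 * b))%:R^-1 * \sum_(1 <= y < n.+1) y%:R^-1)).
  by rewrite ler_pdivlMl ?ltr0n ?muln_gt0 ?expn_gt0 ?b0 // -natrM.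
rewrite mulr_sumr; apply: ler_sum_nat => y /andP[y0 _].
rewrite -invfM -natrM lef_pV2 ?posrE ?ltr0n ?muln_gt0 ?expn_gt0 ?addn_gt0 ?muln_gt0
  ?expn_gt0 ?b0 ?y0 //.
rewrite ler_nat (leq_trans (ltnW (m_lt y))) // -!mulnA leq_mul2l; apply/orP; right; nia.
Qed.

(** * Practical numbers and chains of primes *)

(** The case [m = 0] is included because the quotient in [practical_mul] can vanish. *)
Lemma practicalP (n : nat) : practical n <-> (0 < n)%N /\
  forall m, (m <= n)%N -> exists s : seq nat,
    [/\ uniq s, forall d, d \in s -> (d %| n)%N & m = (\sum_(d <- s) d)%N].
Proof.
split=> [[n0 nP]|[n0 nP]]; split=> // m.
  case: (posnP m) => [-> _|m0 mn]; first by exists [::]; rewrite big_nil.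
  by have [D [Dn mE]] := nP m m0 mn; exists D; rewrite fset_uniq.
move=> _ /nP[s [us sn ->]]; exists [fset d in s]%fset.
split=> [d|]; first by rewrite inE; apply: sn.
by apply: perm_big; apply: uniq_perm => // [|d]; rewrite ?fset_uniq ?inE.
Qed.

(** Divide [m] by [k]: the divisors of [n] that sum to the quotient become multiples of [k] after
    scaling, while those that make up the remainder are not multiples of [k]. Hence no divisor
    occurs twice. *)
Lemma practical_mul (n k : nat) : (0 < k)%N -> practical n ->
    (forall r, (r < k)%N -> exists s : seq nat, [/\ uniq s,
       forall d, d \in s -> (d %| n * k)%N /\ ~~ (k %| d)%N & r = (\sum_(d <- s) d)%N]) ->
  practical (n * k).
Proof.
move=> k0 /practicalP[n0 nP] kP; apply/practicalP; split=> [|m mnk].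
  by rewrite muln_gt0 n0.
have [|s [us sn qE]] := nP (m %/ k)%N; first by rewrite -(mulnK n k0) leq_div2r.
have [|r [ur rnk rE]] := kP (m %% k)%N; first by rewrite ltn_mod.
exists ([seq d * k | d <- s] ++ r)%N; split.
- rewrite cat_uniq ur andbT map_inj_uniq ?us /=; last first.
    by move=> d e /eqP; rewrite eqn_pmul2r // => /eqP.
  by apply/hasPn => d /rnk[_]; apply: contra => /mapP[e _ ->]; apply: dvdn_mull.
- move=> d; rewrite mem_cat => /orP[/mapP[e /sn en ->]|/rnk[]//].
  by rewrite dvdn_pmul2r.
- by rewrite big_cat big_map -big_distrl /= -qE -rE -divn_eq.
Qed.

Lemma practical_double (n : nat) : practical n -> practical (2 * n).
Proof.
move=> nP; rewrite mulnC; apply: practical_mul => // -[_|[_|//]].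
  by exists [::]; rewrite big_nil.
by exists [:: 1%N]; rewrite big_seq1; split=> // d; rewrite inE => /eqP->.
Qed.

(** A remainder below [k <= n] is a sum of divisors of [n], none a multiple of [k]. Coprimality
    instead of primality lets this serve both a prime added to a chain and the odd factor in
    [practical_pow2_mul]. *)
Lemma practical_mul_coprime (n k : nat) : (1 < k)%N -> (k <= n)%N -> coprime k n ->
  practical n -> practical (n * k).
Proof.
move=> k1 kn cokn nP; apply: practical_mul => //; first exact: ltnW.
move=> r rk; have [n0 /(_ r (ltnW (leq_trans rk kn)))[s [us sn rE]]] := (practicalP n).1 nP.
exists s; split=> // d ds; split; first by rewrite dvdn_mulr ?sn.
apply/negP => kd; have := dvdn_gcd k k n.
by rewrite dvdnn (dvdn_trans kd (sn d ds)) (eqP cokn) dvdn1 gtn_eqF.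
Qed.

Lemma practical_pow2_mul (t b : nat) : odd b -> (b <= 2 ^ t)%N -> practical (2 ^ t * b).
Proof.
move=> ob b_le; have P2 : practical (2 ^ t).
  elim: t {b_le} => [|t IHt]; last by rewrite expnS; apply: practical_double.
  split=> // -[//|[_ _|//]]; exists [fset 1%N]%fset; split; last by rewrite big_seq_fset1.
  by move=> d; rewrite inE => /eqP->.
have [b1|b1] := leqP b 1; last first.
  by apply: practical_mul_coprime; rewrite // coprimeXr // coprimen2.
by rewrite (_ : b = 1%N) ?muln1 //; apply/eqP; rewrite eqn_leq b1 odd_gt0.
Qed.

(* The lists p_r > ... > p_1 of primes below k satisfying ok such that
   p_(i+1) <= A p_1 ... p_i for all i. *)
Fixpoint chains (ok : pred nat) (A k : nat) : seq (seq nat) :=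
  if k is j.+1 then
    chains ok A j ++
      (if ok j then [seq j :: l | l <- chains ok A j & (j <= A * \prod_(p <- l) p)%N] else [::])
  else [:: [::]].

Lemma mem_chains (ok : pred nat) (A k : nat) (l : seq nat) :
  l \in chains ok A k -> {in l, forall p, ok p /\ (p < k)%N}.
Proof.
elim: k l => [|k IHk] l /=; first by rewrite inE => /eqP->.
rewrite mem_cat => /orP[/IHk lP p /lP[okp pk]|]; first by split=> //; apply: leqW.
case: ifP => // okk /mapP[l']; rewrite mem_filter => /andP[_ /IHk lP] -> p.
by rewrite inE => /orP[/eqP-> //|/lP[okp pk]]; split=> //; apply: leqW.
Qed.

Lemma prime_dvd_prod_chains (ok : pred nat) (A k p : nat) (l : seq nat) :
    (forall p, ok p -> prime p) -> l \in chains ok A k -> prime p -> (k <= p)%N ->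
  ~~ (p %| \prod_(q <- l) q)%N.
Proof.
move=> okP /mem_chains lP pp kp; rewrite big_seq; elim/big_rec: _ => [|q x /lP[okq qk] px].
  by rewrite dvdn1 gtn_eqF // prime_gt1.
by rewrite Euclid_dvdM // negb_or px andbT dvdn_prime2 ?(okP q okq) // gtn_eqF // (leq_trans qk).
Qed.

Lemma prod_chains_gt0 (ok : pred nat) (A k : nat) (l : seq nat) :
  (forall p, ok p -> prime p) -> l \in chains ok A k -> (0 < \prod_(q <- l) q)%N.
Proof.
move=> okP /mem_chains lP; rewrite big_seq; elim/big_rec: _ => [//|q x /lP[okq qk] x0].
by rewrite muln_gt0 x0 prime_gt0 ?okP.
Qed.

(** Products of the chains added at [k] are divisible by [k], the earlier ones are not. Distinct
    chains thus give distinct denominators. *)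
Lemma uniq_prod_chains (ok : pred nat) (A k : nat) : (forall p, ok p -> prime p) ->
  uniq [seq (\prod_(p <- l) p)%N | l <- chains ok A k].
Proof.
move=> okP; elim: k => [|k IHk] //=.
case: ifP => [okk|]; last by rewrite cats0.
have k0 : (0 < k)%N by rewrite prime_gt0 ?okP.
rewrite map_cat -map_comp cat_uniq IHk /=; apply/andP; split.
  apply/hasPn => n /mapP[l _ ->] /=; rewrite big_cons.
  apply/mapP => -[l' l'k E]; have := prime_dvd_prod_chains okP l'k (okP k okk) (leqnn k).
  by rewrite -E dvdn_mulr.
rewrite (@eq_map _ _ _ ((fun n => k * n)%N \o (fun l => \prod_(p <- l) p)%N)); last first.
  by move=> l /=; rewrite big_cons.
rewrite map_comp map_inj_uniq => [|m n /eqP]; last by rewrite eqn_pmul2l // => /eqP.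
by apply: subseq_uniq IHk; apply: map_subseq; apply: filter_subseq.
Qed.

Lemma chains_cat (ok : pred nat) (A j k : nat) : (j <= k)%N ->
  exists s, chains ok A k = chains ok A j ++ s.
Proof.
move=> /subnK<-; elim: (k - j)%N => [|i [s IHi]]; first by exists [::]; rewrite cats0.
by rewrite addSn /= {1}IHi -catA; eexists.
Qed.

Lemma practical_chains (ok : pred nat) (N k : nat) (l : seq nat) :
    (forall p, ok p -> prime p /\ ~~ (p %| N)%N) -> practical N -> l \in chains ok N k ->
  practical (N * \prod_(p <- l) p).
Proof.
move=> okP NP; have okp p (okp : ok p) := (okP p okp).1.
elim: k l => [|k IHk] l /=; first by rewrite inE => /eqP->; rewrite big_nil muln1.
rewrite mem_cat => /orP[/IHk //|]; case: ifP => // okk /mapP[l'].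
rewrite mem_filter => /andP[kN l'k] ->; rewrite big_cons mulnCA mulnC.
have [pk kN'] := okP k okk.
apply: practical_mul_coprime => //; [exact: prime_gt1| |exact: IHk].
rewrite prime_coprime // Euclid_dvdM // negb_or kN' /=.
exact: prime_dvd_prod_chains l'k _ _.
Qed.

(** * Sums and products over primes *)

Section Mertens.
Variable R : realType.
Implicit Types (n N M p : nat) (e : R).

Local Notation lnn n := (ln (n%:R : R)).

Lemma ler_sum_subset (T : eqType) (s1 s2 : seq T) (F : T -> R) :
    uniq s1 -> {subset s1 <= s2} -> (forall x, x \in s2 -> 0 <= F x) ->
  \sum_(x <- s1) F x <= \sum_(x <- s2) F x.
Proof.
elim: s1 s2 => [|x s1 IHs] s2 /=.
  by move=> _ _ F0; rewrite big_nil big_seq sumr_ge0.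
move=> /andP[xs1 us1] s12 F0; have xs2 := s12 x (mem_head x s1).
rewrite big_cons (perm_big _ (perm_to_rem xs2)) big_cons lerD2l; apply: IHs => // y ys.
  have : y \in x :: rem x s2 by rewrite -(perm_mem (perm_to_rem xs2)) s12 // inE ys orbT.
  by rewrite inE => /orP[/eqP yx|//]; rewrite -yx ys in xs1.
by apply: F0; apply: mem_rem ys.
Qed.

Lemma lnn_ge0 n : 0 <= lnn n.
Proof. by case: n => [|n]; [rewrite ln0|rewrite ln_ge0 // ler1n]. Qed.

Lemma ler_lnn m n : (0 < m)%N -> (m <= n)%N -> lnn m <= lnn n.
Proof.
by move=> m0 mn; rewrite ler_ln ?posrE ?ltr0n ?ler_nat // (leq_trans m0).
Qed.

Lemma lnn_mul m n : (0 < m)%N -> (0 < n)%N -> lnn (m * n) = lnn m + lnn n.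
Proof. by move=> m0 n0; rewrite natrM lnM // posrE ltr0n. Qed.

Lemma lnnS n : (0 < n)%N -> lnn n.+1 - lnn n <= n%:R^-1.
Proof.
move=> n0; have nR : 0 < n%:R :> R by rewrite ltr0n.
rewrite -ln_div ?posrE ?ltr0n // -natr1 mulrDl mulfV ?gt_eqF // div1r.
by apply: le_ln1Dx; rewrite (@lt_trans _ _ 0) ?oppr_lt0 ?invr_gt0.
Qed.

Lemma lnnS_mul n : (0 < n)%N -> n%:R * (lnn n.+1 - lnn n) <= 1.
Proof. by move=> n0; rewrite -ler_pdivlMl ?ltr0n // mulr1 lnnS. Qed.

Lemma le_ln_harmonic N : (0 < N)%N -> lnn N <= \sum_(1 <= i < N) i%:R^-1.
Proof.
case: N => // N _; elim: N => [|N IHN]; first by rewrite ln1 big_geq.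
rewrite big_nat_recr //= addrC; have := @lnnS N.+1 isT.
by rewrite lerBlDr => /le_trans; apply; rewrite lerD2l.
Qed.

Lemma ln_fact_ge N : (0 < N)%N -> N%:R * lnn N - N%:R <= lnn N`!.
Proof.
case: N => // N _; elim: N => [|N IHN]; first by rewrite ln1; lra.
rewrite factS lnn_mul ?fact_gt0 //.
have := @lnnS_mul N.+1 isT; move: IHN; rewrite -[N.+2%:R]natr1.
set n := N.+1%:R : R; set f := ln (_`!)%:R; set x := ln n; set y := ln (n + 1); nra.
Qed.

(** Legendre's formula against a geometric series; carrying [n %/ p ^ m] through the induction
    absorbs the floors. *)
Lemma logn_fact_le p n : prime p -> (logn p n`! * p.-1 <= n)%N.
Proof.
move=> pp; have p0 := prime_gt0 pp; rewrite logn_fact //.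
suff H m : ((\sum_(1 <= k < m.+1) n %/ p ^ k) * p.-1 + n %/ p ^ m <= n)%N.
  by apply: leq_trans (H n); apply: leq_addr.
elim: m => [|m IHm]; first by rewrite big_geq // expn0 divn1.
rewrite big_nat_recr //= mulnDl -addnA; apply: leq_trans IHm; rewrite leq_add2l.
rewrite -mulnSr prednK // expnSr divnMA; exact: leq_trunc_div.
Qed.

Lemma ln_fact_prime_sum N : lnn N`! = \sum_(0 <= p < N.+1 | prime p) (logn p N`!)%:R * lnn p.
Proof.
have ln_prod (s : seq nat) (e : nat -> nat) :
    lnn (\prod_(p <- s | prime p) p ^ e p) = \sum_(p <- s | prime p) (e p)%:R * lnn p.
  elim: s => [|p s IHs]; first by rewrite !big_nil ln1.
  rewrite !big_cons; case: ifP => // pp; have p0 := prime_gt0 pp.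
  rewrite lnn_mul ?expn_gt0 ?p0 //; last first.
    by rewrite prodn_cond_gt0 // => q /prime_gt0 q0; rewrite expn_gt0 q0.
  by rewrite IHs natrX lnXn ?ltr0n // mulr_natl.
rewrite -[in LHS](partnT (fact_gt0 N)) (widen_partn predT (leqnn _)).
rewrite (bigID prime) /= [X in (_ * X)%N]big1 => [|p np]; last by rewrite lognE (negbTE np).
rewrite muln1 ln_prod (@big_cat_nat _ _ _ N.+1) //=; last by rewrite ltnS fact_geq.
rewrite [X in _ + X]big1_seq ?addr0 // => p; rewrite mem_index_iota => /and3P[pp Np _].
rewrite logn_fact // big1_seq ?mul0r // => k; rewrite mem_index_iota => /andP[_ /andP[k0 _]].
rewrite divn_small // (leq_trans Np) // -{1}(expn1 p) leq_exp2l //; exact: prime_gt1.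
Qed.

(** Lower half of Mertens' first theorem. Comparing [ln_fact_ge] with [logn_fact_le] gives it for
    [p.-1] with a loss of 1; passing to [p.+1] costs at most twice the sum in [H2], hence 4. For
    [a_p = 1 / p] the prime [p] is chosen with probability [1 / p.+1], whence this denominator. *)
Lemma mertens N : (0 < N)%N ->
  lnn N - 5 <= \sum_(0 <= p < N.+1 | prime p) lnn p / p.+1%:R.
Proof.
move=> N0; have NR : 0 < N%:R :> R by rewrite ltr0n.
have H1 : lnn N - 1 <= \sum_(0 <= p < N.+1 | prime p) lnn p / p.-1%:R.
  rewrite -(ler_pM2l NR) mulrBr mulr1 (le_trans (ln_fact_ge N0)) // ln_fact_prime_sum mulr_sumr.
  apply: ler_sum => p pp; have p1 := prime_gt1 pp.
  have pR : 0 < p.-1%:R :> R by rewrite ltr0n; case: p p1 {pp} => [|[]].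
  rewrite [leRHS]mulrCA [leLHS]mulrC ler_wpM2l ?lnn_ge0 //.
  by rewrite ler_pdivlMr // -natrM ler_nat logn_fact_le.
(* ln k / (k (k-1)) <= F (k-1) - F k for F k = (ln k + 2) / k. *)
have H2 : \sum_(0 <= p < N.+1 | prime p) lnn p / (p * p.-1)%:R <= 2 - (lnn N + 2) / N%:R.
  case: N N0 {NR H1} => // N _; elim: N => [|N IHN].
    rewrite ln1 add0r divr1 subrr big_mkcond big_nat_recr // big_nat_recr // big_geq //=.
    by rewrite !addr0.
  rewrite big_mkcond big_nat_recr // -big_mkcond /=.
  apply: (@le_trans _ _ (2 - (lnn N.+1 + 2) / N.+1%:R + lnn N.+2 / (N.+2 * N.+1)%:R)).
    by apply: lerD => //; case: ifP => // _; rewrite divr_ge0 ?lnn_ge0.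
  have := @lnnS_mul N.+1 isT; set x := lnn N.+1; set y := lnn N.+2.
  have n0 : 0 < N.+1%:R :> R by rewrite ltr0n.
  rewrite natrM -[N.+2%:R]natr1; set n := N.+1%:R : R in n0 * => yx.
  have n1 : 0 < n + 1 by lra.
  have n_ge1 : 1 <= n by rewrite ler1n.
  clearbody x y n; rewrite -subr_ge0.
  have -> : 2 - (y + 2) / (n + 1) - (2 - (x + 2) / n + y / ((n + 1) * n)) =
      (2 + x - n * (y - x) - y + 0) / ((n + 1) * n) + 0.
    by field; rewrite (gt_eqF n0) (gt_eqF n1).
  rewrite !addr0 divr_ge0 ?mulr_ge0 ?(ltW n0) ?(ltW n1) //.
  nra.
apply: (@le_trans _ _ (\sum_(0 <= p < N.+1 | prime p)
    (lnn p / p.-1%:R - 2 * (lnn p / (p * p.-1)%:R)))).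
  rewrite sumrB -mulr_sumr; have : 0 <= (lnn N + 2) / N%:R.
    by rewrite divr_ge0 ?addr_ge0 ?lnn_ge0 ?(ltW NR).
  by move: H1 H2; lra.
apply: ler_sum => p pp; have p1 := prime_gt1 pp.
case: p p1 pp => [|[|p]] // _ _ /=; rewrite natrM -[p.+3%:R]natr1 -[p.+2%:R]natr1.
have := lnn_ge0 p.+2; rewrite -natr1; set x := ln _ => x0.
have := ltr0Sn R p; set n := p.+1%:R => n0.
rewrite -subr_ge0.
have -> : x / (n + 1 + 1) - (x / n - 2 * (x / ((n + 1) * n))) = 2 * x / ((n + 1 + 1) * (n + 1) * n).
  by field; rewrite !gt_eqF //; lra.
by rewrite divr_ge0 ?mulr_ge0 ?addr_ge0 ?(ltW n0).
Qed.

Lemma mertens_coprime M : (0 < M)%N -> exists K : R, forall N, (0 < N)%N ->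
  lnn N - K <= \sum_(0 <= p < N.+1 | prime p && ~~ (p %| M)%N) lnn p / p.+1%:R.
Proof.
move=> M0; exists (5 + \sum_(p <- primes M) lnn p / p.+1%:R) => N N0.
have := mertens N0; rewrite (bigID (dvdn^~ M)) /=.
have : \sum_(0 <= p < N.+1 | prime p && (p %| M)%N) lnn p / p.+1%:R <=
       \sum_(p <- primes M) lnn p / p.+1%:R.
  rewrite -big_filter; apply: ler_sum_subset => [|p|p _].
  - by rewrite filter_uniq ?iota_uniq.
  - by rewrite mem_filter mem_primes M0 => /andP[/andP[-> ->]].
  - by rewrite divr_ge0 ?lnn_ge0.
lra.
Qed.

(* When only the primes below z are read, e is of order 1 / ln z: the weight of n
   times ln n is then O(ln z / n) by prod_damped_inv_le, also for n far above z. *)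
Definition damped_inv (e : R) (p : nat) : R := (1 - e * lnn p) / p%:R.

Lemma damped_inv_ge0 e p N : 0 <= e -> (0 < p)%N -> (p <= N)%N -> e * lnn N <= 1 ->
  0 <= damped_inv e p.
Proof.
move=> e0 p0 pN eN; rewrite divr_ge0 // subr_ge0 (le_trans _ eN) //.
by rewrite ler_wpM2l // ler_lnn.
Qed.

Lemma damped_inv_le e p : 0 <= e -> damped_inv e p <= p%:R^-1.
Proof.
by move=> e0; rewrite ler_piMl ?invr_ge0 // lerBlDr lerDl mulr_ge0 ?lnn_ge0.
Qed.

Lemma damped_inv_mul_le e k i : 0 <= e -> (0 < k)%N -> (0 < i)%N ->
  damped_inv e (k * i) <= damped_inv e k * damped_inv e i.
Proof.
move=> e0 k0 i0; rewrite /damped_inv lnn_mul // natrM mulf_div ler_wpM2r ?invr_ge0 ?mulr_ge0 //.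
have := mulr_ge0 (mulr_ge0 e0 (lnn_ge0 k)) (mulr_ge0 e0 (lnn_ge0 i)); nra.
Qed.

Lemma damped_inv_le1 e p : 0 <= e -> (0 < p)%N -> damped_inv e p <= 1.
Proof.
by move=> e0 p0; apply: le_trans (damped_inv_le _ e0) _; rewrite invf_le1 ?ltr0n ?ler1n.
Qed.

(* damped_inv is not multiplicative, but damped_inv_mul_le suffices for this half
   of the Euler product formula. *)
Lemma smooth_sum_le e N k : 0 <= e -> e * lnn N <= 1 -> (k <= N)%N ->
  (\prod_(0 <= p < k | prime p) (1 - damped_inv e p)) *
  (\sum_(1 <= j < N | all (fun p => p < k)%N (primes j)) damped_inv e j) <= 1.
Proof.
move=> e0 eN; elim: k => [|k IHk] kN.
  rewrite [X in X * _]big_geq // mul1r -big_filter.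
  apply: (@le_trans _ _ (\sum_(j <- [:: 1%N]) damped_inv e j)); last first.
    by rewrite big_seq1 /damped_inv ln1 mulr0 subr0 divr1.
  apply: ler_sum_subset => [|j|j]; first by rewrite filter_uniq ?iota_uniq.
    rewrite mem_filter mem_index_iota inE => /and3P[jP j0 _]; apply/negPn/negP => j1.
    have := allP jP (pdiv j); rewrite mem_primes pdiv_prime ?pdiv_dvd ?j0 ?ltn0; last by lia.
    by move=> /(_ isT).
  by rewrite inE => /eqP->; rewrite /damped_inv ln1 mulr0 subr0 divr1.
have {}IHk := IHk (ltnW kN).
rewrite big_mkcond big_nat_recr // -big_mkcond /=.
have [pk|npk] := boolP (prime k); last first.
  rewrite mulr1; congr (_ * _ <= _) : IHk; apply: eq_bigl => j.
  apply: eq_in_all => p; rewrite mem_primes => /andP[pp _].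
  by rewrite ltnS [RHS]leq_eqVlt; case: eqP => // pk; rewrite -pk pp in npk.
have k0 := prime_gt0 pk.
set P := \prod_(0 <= p < k | prime p) _; set S := \sum_(1 <= j < N | _) _ in IHk *.
have P0 : 0 <= P by apply: prodr_ge0 => p /prime_gt0 p0; rewrite subr_ge0 damped_inv_le1.
set S' := \sum_(1 <= j < N | _) _.
(* Split by divisibility by [k]: a multiple of [k] is [k * i] with [i] again in the range of [S'];
   the other [j] are those of [S]. *)
suff : S' <= S + damped_inv e k * S'.
  by move=> SS'; rewrite -mulrA (le_trans _ IHk) // ler_wpM2l // mulrBl mul1r lerBlDr.
rewrite {1}/S' (bigID (dvdn k)) /= addrC; apply: lerD.
  rewrite le_eqVlt; apply/orP; left; apply/eqP.
  rewrite big_nat_cond [RHS]big_nat_cond; apply: eq_bigl => j.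
  case j1N: (1 <= j < N)%N => //=; case/andP: j1N => j0 _.
  apply/andP/allP => [[/allP jk kj] p pj|jk].
    have := jk p pj; rewrite ltnS leq_eqVlt => /orP[/eqP pk'|//].
    by move: pj kj; rewrite pk' mem_primes => /and3P[_ _ ->].
  split; first by apply/allP => p /jk /leqW.
  by apply/negP => kj; have := jk k; rewrite mem_primes pk j0 kj ltnn => /(_ isT).
rewrite -big_filter; set s := [seq j <- _ | _].
have sP j : j \in s -> [/\ (0 < j)%N, (j < N)%N, all (fun p => p < k.+1)%N (primes j) & (k %| j)%N].
  by rewrite mem_filter mem_index_iota => /andP[/andP[? ?] /andP[? ?]].
apply: (@le_trans _ _ (\sum_(j <- s) damped_inv e k * damped_inv e (j %/ k))).
  rewrite big_seq [leRHS]big_seq; apply: ler_sum => j /sP[j0 _ _ kj].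
  by rewrite -{1}(divnK kj) mulnC damped_inv_mul_le // divn_gt0 // dvdn_leq.
rewrite -mulr_sumr ler_wpM2l ?(damped_inv_ge0 e0 k0 (ltnW kN) eN) //.
rewrite -(big_map (fun j => j %/ k)%N xpredT (damped_inv e)) /S' -[leRHS]big_filter.
apply: ler_sum_subset => [|i /mapP[j /sP[j0 jN jk kj] ->]|i].
- rewrite map_inj_in_uniq ?filter_uniq ?iota_uniq // => i j /sP[_ _ _ ki] /sP[_ _ _ kj].
  by move=> /(congr1 (muln^~ k)); rewrite !divnK.
- have jk0 : (0 < j %/ k)%N by rewrite divn_gt0 // dvdn_leq.
  rewrite mem_filter mem_index_iota jk0 (leq_ltn_trans (leq_div _ _) jN) /= andbT.
  apply/allP => p; rewrite mem_primes => /and3P[pp _ pj]; apply: (allP jk).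
  by rewrite mem_primes pp j0 (dvdn_trans pj) // -{2}(divnK kj) dvdn_mulr.
by rewrite mem_filter mem_index_iota => /and3P[_ i0 iN]; rewrite (damped_inv_ge0 e0 i0 (ltnW iN)).
Qed.

(** At [k = N] every [j < N] is smooth, and [damped_inv e j] is at least [1 / (2 j)]; so the sum in
    [smooth_sum_le] is at least [lnn N / 2]. *)
Lemma prod_prime_le e N : 0 <= e -> e * lnn N <= 2^-1 ->
  (\prod_(0 <= p < N | prime p) (1 - damped_inv e p)) * lnn N <= 2.
Proof.
move=> e0 eN; case: (posnP N) => [->|N0]; first by rewrite ln0 // mulr0.
have eN1 : e * lnn N <= 1 by apply: le_trans eN _; rewrite invf_le1 // ler1n.
have := smooth_sum_le e0 eN1 (leqnn N); set P := \prod_(_ <= _ < _ | _) _.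
have P0 : 0 <= P by apply: prodr_ge0 => p /prime_gt0 p0; rewrite subr_ge0 damped_inv_le1.
set S := \sum_(_ <= _ < _ | _) _; suff : 2^-1 * lnn N <= S by nra.
apply: (@le_trans _ _ (2^-1 * \sum_(1 <= i < N) i%:R^-1)).
  by rewrite ler_wpM2l ?invr_ge0 // le_ln_harmonic.
rewrite mulr_sumr /S big_nat_cond [leRHS]big_nat_cond.
rewrite [leRHS](eq_bigl (fun j => (1 <= j < N)%N && true)); last first.
  move=> j; case j1N: (1 <= j < N)%N => //=; case/andP: j1N => j0 jN.
  apply/allP => p; rewrite mem_primes => /and3P[_ _ /dvdn_leq pj].
  by apply: leq_ltn_trans jN; apply: pj.
apply: ler_sum => j; rewrite andbT => /andP[j0 jN].
rewrite ler_wpM2r ?invr_ge0 // lerBrDr -lerBrDl.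
apply: le_trans (_ : e * lnn N <= _); first by rewrite ler_wpM2l // ler_lnn // ltnW.
by apply: le_trans eN _; lra.
Qed.

(** Since [(1 + a)^-1 <= (1 - a) / (1 - p^-2)], this reduces to [prod_prime_le]. The constant
    collects 2 from there, 2 from the product of the [1 - p^-2], and 2 for each prime dividing [M],
    whose factor [1 - a] is at least 1/2. *)
Lemma prod_coprime_le M : (0 < M)%N -> exists2 C : R, 0 <= C &
  forall e N, 0 <= e -> (1 < N)%N -> e * lnn N <= 2^-1 ->
  (\prod_(0 <= p < N | prime p && ~~ (p %| M)%N) (1 + damped_inv e p)^-1) * lnn N <= C.
Proof.
move=> M0; exists (4 * 2 ^+ size (primes M)) => [|e N e0 N1 eN].
  by rewrite mulr_ge0 ?exprn_ge0.
have eN1 : e * lnn N <= 1 by apply: le_trans eN _; rewrite invf_le1 // ler1n.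
have a0 p : prime p -> (p < N)%N -> 0 <= damped_inv e p.
  by move=> /prime_gt0 p0 /ltnW pN; apply: damped_inv_ge0 eN1.
have a_half p : prime p -> damped_inv e p <= 2^-1.
  move=> /prime_gt1 p1; apply: le_trans (damped_inv_le _ e0) _.
  by rewrite lef_pV2 ?posrE ?ler_nat ?ltr0n // ltnW.
set ok := fun p => prime p && ~~ (p %| M)%N.
set P := \prod_(0 <= p < N | ok p) (1 - damped_inv e p).
have P0 : 0 <= P.
  by apply: prodr_ge0 => p /andP[/prime_gt0 p0 _]; rewrite subr_ge0 damped_inv_le1.
have squares : 2^-1 <= \prod_(0 <= p < N | ok p) (1 - p%:R^-1 ^+ 2) :> R.
  case: N N1 {eN eN1 a0 P P0} => [|[|n]] // _.
  (* Over all integers from 2 to [n.+1] the product telescopes to the left side; omitting factors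
     only enlarges it. *)
  have H : (n.+1%:R + 1) / (2 * n.+1%:R) <= \prod_(0 <= p < n.+2 | ok p) (1 - p%:R^-1 ^+ 2) :> R.
    elim: n => [|n IHn].
      rewrite big_mkcond big_nat_recr // big_nat_recr // big_geq //= !mulr1.
      by rewrite divff // (_ : 1 + 1 = 2 :> R) // pnatr_eq0.
    rewrite big_mkcond big_nat_recr // -big_mkcond /=; move: IHn.
    rewrite -[n.+2%:R]natr1; set Q := \prod_(_ <= _ < _ | _) _; have := ltr0Sn R n.
    set x := n.+1%:R => x0 leQ; clearbody x Q; have x1 : 0 < x + 1 by lra.
    apply: (@le_trans _ _ ((x + 1) / (2 * x) * (1 - (x + 1)^-1 ^+ 2))).
      rewrite le_eqVlt; apply/orP; left; apply/eqP; field.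
      by rewrite (gt_eqF x0) (gt_eqF x1).
    have x2 : 0 <= (x + 1)^-1 ^+ 2 by rewrite sqr_ge0.
    have x3 : (x + 1)^-1 ^+ 2 <= 1 by rewrite expr_le1 // ?invf_le1 ?invr_ge0 ?(ltW x1) //; lra.
    have y0 : 0 <= (x + 1) / (2 * x) by rewrite divr_ge0 //; lra.
    case: ifP => _; nra.
  apply: le_trans H; have := ltr0Sn R n; set x := n.+1%:R => x0.
  by rewrite ler_pdivlMr; lra.
have le1 : \prod_(0 <= p < N | ok p) (1 + damped_inv e p)^-1 <= 2 * P.
  apply: (@le_trans _ _ (P * (\prod_(0 <= p < N | ok p) (1 - p%:R^-1 ^+ 2))^-1)); last first.
    rewrite mulrC ler_wpM2r // -[leRHS]invrK lef_pV2 ?posrE ?invr_gt0 //.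
    by apply: lt_le_trans squares; rewrite invr_gt0.
  rewrite -prodfV -big_split /= big_nat_cond [leRHS]big_nat_cond; apply: ler_prod => p.
  move=> /andP[/andP[_ pN] /andP[pp _]]; have := a0 p pp pN; have := a_half p pp.
  have := damped_inv_le p e0; have : p%:R^-1 <= 2^-1 :> R.
    by rewrite lef_pV2 ?posrE ?ler_nat ?ltr0n ?prime_gt0 ?prime_gt1.
  set a := damped_inv e p; set x := p%:R^-1 => x2 ax a2 a0'; rewrite invr_ge0 addr_ge0 //=.
  have y0 : 0 < 1 - x ^+ 2 by nra.
  have a1 : 0 < 1 + a by rewrite ltr_pwDl.
  rewrite ler_pdivlMr // mulrC ler_pdivrMr //.
  have -> : (1 - a) * (1 + a) = 1 - a ^+ 2 by ring.
  by rewrite lerD2l lerN2 ler_sqr ?nnegrE // (le_trans a0').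
set Q := \prod_(0 <= p < N | prime p && (p %| M)%N) (1 - damped_inv e p).
have Q2 : 1 <= 2 ^+ size (primes M) * Q.
  have Q1 : (2^-1) ^+ size (primes M) <= Q.
    rewrite /Q -big_filter; set s := filter _ _.
    have sM : (size s <= size (primes M))%N.
      apply: uniq_leq_size => [|p]; first by rewrite filter_uniq ?iota_uniq.
      by rewrite mem_filter mem_primes M0 => /andP[/andP[-> ->]].
    apply: (@le_trans _ _ (2^-1 ^+ size s)).
      by rewrite ler_wiXn2l // ?invr_ge0 // invf_le1 // ler1n.
    rewrite -[leLHS]mulr1 -iter_mulr -(count_predT s) -big_const_seq.
    rewrite big_seq [leRHS]big_seq; apply: ler_prod => p.
    rewrite mem_filter => /andP[/andP[pp _] _]; rewrite invr_ge0 ler0n /=.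
    by have := a_half p pp; lra.
  by rewrite -ler_pdivrMl ?exprn_gt0 // mulr1 -exprVn.
have := prod_prime_le e0 eN; rewrite (bigID (dvdn^~ M)) /= -/Q -/P => QP.
have := lnn_ge0 N; set l := ln _ in QP * => l0.
apply: (@le_trans _ _ (2 * P * l)); first by rewrite ler_wpM2r.
have PlQ : P * l <= P * l * (2 ^+ size (primes M) * Q) by rewrite ler_peMr ?mulr_ge0.
have : 0 <= 2 ^+ size (primes M) :> R by rewrite exprn_ge0.
move: PlQ QP; set D := 2 ^+ _; nra.
Qed.

(** * The stopped martingale *)

Section ChainSum.
Variables (ok : pred nat) (A : nat) (a : nat -> R).

(** The probability that no admissible prime below [N] is chosen. *)
Definition survival N := \prod_(0 <= p < N | ok p) (1 + a p)^-1.

(** The mean of the logarithm of the product of the chosen primes below [N]. *)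
Definition drift N := \sum_(0 <= p < N | ok p) lnn p * (a p / (1 + a p)).

(* If each prime p is chosen with probability a p / (1 + a p), then
   (\prod_(p <- l) a p) * survival m is the probability that the primes of l are
   the ones chosen below m. A chain with product n stops at A n + 1. *)
Definition chain_term (k : nat) (l : seq nat) : R :=
  let m := minn k (A * \prod_(p <- l) p).+1 in
  (\prod_(p <- l) a p) * survival m * (lnn (\prod_(p <- l) p) - drift m).

Lemma survivalS N : survival N.+1 = survival N * (if ok N then (1 + a N)^-1 else 1).
Proof. by rewrite /survival big_mkcond big_nat_recr // -big_mkcond. Qed.

Lemma driftS N : drift N.+1 = drift N + (if ok N then lnn N * (a N / (1 + a N)) else 0).
Proof. by rewrite /drift big_mkcond big_nat_recr // -big_mkcond. Qed.

(* Martingale property: reading the prime k replaces the term of each chain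
   that is still active by two terms with the same sum. *)
Lemma sum_chain_term k : (forall p, ok p -> prime p) -> (0 < A)%N ->
    (forall p, ok p -> (p < k)%N -> 1 + a p != 0) ->
  \sum_(l <- chains ok A k) chain_term k l = 0.
Proof.
move=> okP A0; elim: k => [|k IHk] a1.
  by rewrite /= big_seq1 /chain_term min0n /= /drift !big_nil ln1 subrr mulr0.
rewrite -[RHS]IHk => [|p okp pk]; last by apply: a1 => //; apply: leqW.
rewrite /=; case: (boolP (ok k)) => [okk|nokk]; last first.
  rewrite cats0; apply: eq_bigr => l _; rewrite /chain_term minnSS.
  set x := (_ * _)%N; case: (leqP k x) => kx.
    rewrite (minn_idPl (leqW kx)) survivalS driftS (negbTE nokk).
    by rewrite mulr1 addr0.
  by rewrite (minn_idPr kx).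
rewrite big_cat big_map big_filter [X in _ + X = _]big_mkcond -big_split /=.
rewrite big_seq [RHS]big_seq; apply: eq_bigr => l lk; have v0 := prod_chains_gt0 okP lk.
have k0 := prime_gt0 (okP k okk).
rewrite /chain_term !big_cons minnSS; set v := (\prod_(p <- l) p)%N in v0 *.
(* If [A * v < k], the chain has stopped and its term is frozen. Otherwise the chain and its
   extension by [k] are both evaluated at [k.+1]. *)
case: (leqP k (A * v)) => kx; last by rewrite (minn_idPr kx) addr0.
rewrite minnSS !(minn_idPl _) ?leqW //; last by rewrite mulnCA leq_pmulr // muln_gt0 A0.
rewrite survivalS driftS okk lnn_mul //.
by field; apply: a1.
Qed.

End ChainSum.

(** Each prime preserves the bound by [(1 - x) * (1 + x + y) <= 1 + y]. For a chain with product [n]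
    it bounds the weight times [ln n] by [1 / (e n)], however large [n] is. *)
Lemma prod_damped_inv_le e (l : seq nat) : 0 <= e ->
    (forall p, p \in l -> (0 < p)%N /\ e * lnn p <= 1) ->
  (\prod_(p <- l) damped_inv e p) * (1 + e * lnn (\prod_(p <- l) p)) <= (\prod_(p <- l) p)%:R^-1.
Proof.
move=> e0; elim: l => [|p l IHl] lP; first by rewrite !big_nil ln1 mulr0 addr0 mulr1 invr1.
have [p0 ep] := lP p (mem_head p l).
have {}lP q : q \in l -> (0 < q)%N /\ e * lnn q <= 1 by move=> ql; apply: lP; rewrite inE ql orbT.
have {IHl} := IHl lP; rewrite !big_cons.
have v0 : (0 < \prod_(q <- l) q)%N.
  by rewrite big_seq; elim/big_rec: _ => // q x /lP[q0 _] x0; rewrite muln_gt0 q0.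
have g0 : 0 <= \prod_(q <- l) damped_inv e q.
  rewrite big_seq; apply: prodr_ge0 => q /lP[q0 eq].
  exact: damped_inv_ge0 e0 q0 (leqnn q) eq.
rewrite lnn_mul // natrM invfM /damped_inv [e * (_ + _)]mulrDr; move: g0 (mulr_ge0 e0 (lnn_ge0 p)).
move: (mulr_ge0 e0 (lnn_ge0 (\prod_(q <- l) q)%N)) ep.
set g := \prod_(q <- l) _; set x := e * lnn p; set y := e * _; set w := _^-1 => y0 x1 g0 x0 gw.
have -> : (1 - x) / p%:R * g * (1 + (x + y)) = p%:R^-1 * (g * ((1 - x) * (1 + (x + y)))) by ring.
rewrite ler_wpM2l ?invr_ge0 //; apply: le_trans gw; rewrite ler_wpM2l //; nra.
Qed.

Lemma chain_term_le (ok : pred nat) (A z : nat) (C e : R) (l : seq nat) :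
    (forall p, ok p -> prime p) -> (0 < A)%N -> 0 <= C -> 0 < e -> (1 < z)%N ->
    e * lnn z = 2^-1 ->
    (forall N, (1 < N)%N -> e * lnn N <= 2^-1 ->
      survival ok (damped_inv e) N * lnn N <= C) ->
    l \in chains ok A z ->
  chain_term ok A (damped_inv e) z l <= 2 * C * (\prod_(p <- l) p)%:R^-1.
Proof.
move=> okP A0 C0 e0 z1 ez survP lz.
have le_ez N : (0 < N)%N -> (N <= z)%N -> e * lnn N <= 2^-1.
  by move=> N0 Nz; rewrite -ez ler_wpM2l ?(ltW e0) // ler_lnn.
have half1 : 2^-1 <= 1 :> R by rewrite invf_le1 // ler1n.
have a0 p : ok p -> (p < z)%N -> 0 <= damped_inv e p.
  move=> /okP/prime_gt0 p0 /ltnW pz; apply: (damped_inv_ge0 (ltW e0) p0 (leqnn p)).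
  by apply: le_trans half1; apply: le_ez.
have v0 := prod_chains_gt0 okP lz.
have gv : (\prod_(p <- l) damped_inv e p) * (1 + e * lnn (\prod_(p <- l) p)) <=
    (\prod_(p <- l) p)%:R^-1.
  apply: prod_damped_inv_le => [|p /(mem_chains lz)[okp pz]]; first exact: ltW.
  have p0 := prime_gt0 (okP p okp); split=> //.
  by apply: le_trans half1; apply: le_ez (ltnW pz).
have g0 : 0 <= \prod_(p <- l) damped_inv e p.
  by rewrite big_seq; apply: prodr_ge0 => p /(mem_chains lz)[]; apply: a0.
rewrite /chain_term /=; set v := (\prod_(p <- l) p)%N in v0 gv *.
set g := \prod_(p <- l) _ in gv g0 *; set m := minn _ _.
have mz : (m <= z)%N by apply: geq_minl.
have m1 : (1 < m)%N by rewrite leq_min z1 ltnS muln_gt0 A0.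
have S0 : 0 <= survival ok (damped_inv e) m.
  rewrite /survival big_nat_cond; apply: prodr_ge0 => p /andP[/andP[_ pm] okp].
  by rewrite invr_ge0 addr_ge0 // a0 // (leq_trans pm).
have D0 : 0 <= drift ok (damped_inv e) m.
  rewrite /drift big_nat_cond; apply: sumr_ge0 => p /andP[/andP[_ pm] okp].
  have a0p : 0 <= damped_inv e p by rewrite a0 // (leq_trans pm).
  by rewrite mulr_ge0 ?lnn_ge0 // divr_ge0 // addr_ge0.
have := survP m m1 (le_ez m (ltnW m1) mz).
set S := survival _ _ _ in S0 *; set D := drift _ _ _ in D0 *; set w := _^-1 in gv *.
have x0 := lnn_ge0 v; set x := lnn v in gv x0 * => Sm.
apply: (@le_trans _ _ (g * (S * x))).
  by rewrite -mulrA ler_wpM2l // ler_wpM2l // lerBlDr lerDl.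
have ex0 : 0 <= e * x by rewrite mulr_ge0 // ltW.
have g_le : g <= w by apply: le_trans gv; rewrite ler_peMr // lerDl.
(* If reading goes on up to [z], survival is at most [C / lnn z = 2 * C * e], and [gv] absorbs
   [e * x]. If it stops earlier, then [v <= m], and the survival bound at [m] already controls
   [lnn v]. *)
have [zv|vz] := leqP z (A * v).+1.
  have mE : m = z by rewrite /m (minn_idPl zv).
  rewrite mE in Sm; have S_le : S <= 2 * C * e.
    have : e * (S * lnn z) <= e * C by rewrite ler_wpM2l // ltW.
    by rewrite mulrCA ez; lra.
  apply: (@le_trans _ _ (g * (2 * C * e * x))); first by rewrite ler_wpM2l // ler_wpM2r.
  have -> : g * (2 * C * e * x) = 2 * C * (g * (e * x)) by ring.
  rewrite ler_wpM2l ?mulr_ge0 //; apply: le_trans gv; rewrite ler_wpM2l //; lra.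
have vm : (v <= m)%N.
  by rewrite /m (minn_idPr (ltnW vz)) leqW // leq_pmull.
have Sx : S * x <= C by apply: le_trans Sm; rewrite ler_wpM2l // ler_lnn.
apply: (@le_trans _ _ (w * C)); first by rewrite ler_pM // mulr_ge0.
have : 0 <= w * C by rewrite mulr_ge0 // (le_trans g0).
by rewrite -mulrA [C * w]mulrC; lra.
Qed.

(** For [a = (1 - x) / p] with [x = e * lnn p], the ratio [a / (1 + a)] is [(1 - x) / (p + 1 - x)],
    at least [(1 - x) / (p + 1)]. The loss caused by damping vanishes as [e] tends to 0 with [N]
    fixed. *)
Lemma drift_ge (ok : pred nat) (K e : R) N :
    (forall p, ok p -> prime p) -> 0 <= e -> e * lnn N <= 1 ->
    lnn N - K <= \sum_(0 <= p < N.+1 | ok p) lnn p / p.+1%:R ->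
  lnn N - K - e * \sum_(0 <= p < N.+1 | ok p) lnn p ^+ 2 / p.+1%:R <=
    drift ok (damped_inv e) N.+1.
Proof.
move=> okP e0 eN leK; rewrite lerBlDr (le_trans leK) // mulr_sumr -big_split /=.
rewrite big_nat_cond [leRHS]big_nat_cond; apply: ler_sum => p /andP[/andP[_ pN] /okP pp].
have p0 := prime_gt0 pp; have x0 := lnn_ge0 p.
have ex1 : e * lnn p <= 1 by apply: le_trans eN; rewrite ler_wpM2l // ler_lnn.
have ex0 : 0 <= e * lnn p by rewrite mulr_ge0.
have q0 : 0 < p%:R :> R by rewrite ltr0n.
rewrite /damped_inv -natr1; set q := p%:R in q0 *; set x := lnn p in x0 ex0 ex1 *.
clearbody q x; rewrite -lerBlDr.
have -> : x / (q + 1) - e * (x ^+ 2 / (q + 1)) = x * ((1 - e * x) / (q + 1)).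
  by field; rewrite gt_eqF // addr_gt0.
rewrite ler_wpM2l //.
have -> : (1 - e * x) / q / (1 + (1 - e * x) / q) = (1 - e * x) / (q + (1 - e * x)).
  have qx : 0 < q + (1 - e * x) by rewrite ltr_pwDl // subr_ge0.
  by field; rewrite (gt_eqF qx) (gt_eqF q0).
rewrite ler_wpM2l ?subr_ge0 // lef_pV2 ?posrE ?ltr_pwDl ?subr_ge0 //.
by rewrite lerD2l lerBlDr lerDl.
Qed.

(** If the sums were bounded, some [k0] would leave at most [eta] for all later chains; only then is
    [z] taken large, that is, [e] small. Chains of [chains ok A k0] have non-positive terms, the
    empty one at most [- c], and the later ones add at most [2 * C1 * eta < c], against the total
    0. *)
Lemma sum_chains_unbounded M : (0 < M)%N -> exists A0 : nat, forall A, (A0 <= A)%N ->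
  forall C : R, exists k, C <=
    \sum_(l <- chains (fun p => prime p && ~~ (p %| M)%N) A k) (\prod_(p <- l) p)%:R^-1.
Proof.
move=> M0; set ok := fun p => prime p && ~~ (p %| M)%N.
have okP p : ok p -> prime p by case/andP.
have [K mertK] := mertens_coprime M0; have [C1 C10 survC1] := prod_coprime_le M0.
have large (x : R) : exists2 n, (1 < n)%N & x <= lnn n.
  exists (Num.truncn (expR x)).+2 => //.
  rewrite -{1}(expRK x) ler_ln ?posrE ?expR_gt0 ?ltr0n // ltW //.
  by apply: lt_trans (truncnS_gt _) _; rewrite ltr_nat.
(* The 2 leaves room in [head] for the bound -1 after a damping loss of at most 1/2. *)
have [A0 A01 A0K] := large (K + 2); exists A0 => A A0A C.
have A_gt0 : (0 < A)%N by apply: leq_trans A0A; apply: ltnW.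
have AK : K + 2 <= lnn A by apply: le_trans A0K _; apply: ler_lnn (ltnW A01) A0A.
pose U k := \sum_(l <- chains ok A k) ((\prod_(p <- l) p)%:R : R)^-1.
have [//|bounded] := pselect (exists k, C <= U k); exfalso.
have {}bounded k : U k < C by rewrite ltNge; apply/negP => Ck; apply: bounded; exists k.
(* Otherwise increments above some [eta] could be repeated until [U] passes [C]. *)
have [eta_k|] := pselect (forall eta : R, 0 < eta ->
    exists k, forall j, U j <= U k + eta); last first.
  apply=> eta eta0; have [//|noeta] := pselect (exists k, forall j, U j <= U k + eta); exfalso.
  have step k : exists j, U k + eta < U j.
    have [//|nostep] := pselect (exists j, U k + eta < U j); exfalso; apply: noeta; exists k => j.
    by rewrite leNgt; apply/negP => lt; apply: nostep; exists j.
  have grow n : exists k, n%:R * eta <= U k.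
    elim: n => [|n [k kn]]; first by exists 0%N; rewrite mul0r sumr_ge0 // => l _; rewrite invr_ge0.
    have [j kj] := step k; exists j; rewrite -natr1 mulrDl mul1r (le_trans _ (ltW kj)) //.
    by rewrite lerD2r.
  have [k] := grow (Num.truncn (C / eta)).+1; apply/negP; rewrite -ltNge.
  apply: lt_trans (bounded k) _; rewrite -ltr_pdivrMr //; exact: truncnS_gt.
(* The undamped weights make [c] independent of [e], which is chosen after [eta]. *)
pose c := survival ok (fun p => (p%:R : R)^-1) A.+1.
have c0 : 0 < c.
  by apply: prodr_gt0 => p _; rewrite invr_gt0 ltr_pwDl // invr_ge0.
pose eta := c / (2 * C1 + 1).
have C1_gt0 : 0 < 2 * C1 + 1 by rewrite ltr_wpDl // mulr_ge0.
have [|k0 k0P] := eta_k eta; first by rewrite divr_gt0.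
pose th l := (A * \prod_(p <- l) p)%N.
pose Q l := \sum_(0 <= p < (th l).+1 | ok p) lnn p ^+ 2 / p.+1%:R.
have Q0 l : 0 <= Q l by apply: sumr_ge0 => p _; rewrite divr_ge0 ?exprn_ge0 ?lnn_ge0.
(* [Th] makes every chain of [chains ok A k0] stop by [z]; [z1] ensures [e * Q l <= 2^-1] for each
   of them. *)
pose Th := (\max_(l <- chains ok A k0) (th l).+1)%N.
have [z1 z1_gt1 z1Q] := large (\sum_(l <- chains ok A k0) Q l).
pose z := (k0 + Th + z1)%N.
have z_gt1 : (1 < z)%N by rewrite (leq_trans z1_gt1) // leq_addl.
have lnz0 : 0 < lnn z by rewrite ln_gt0 // ltr1n.
pose e := (2 * lnn z)^-1.
have e0 : 0 < e by rewrite invr_gt0 mulr_gt0.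
have ez : e * lnn z = 2^-1 by rewrite /e invfM -mulrA mulVf ?mulr1 // gt_eqF.
have le_ez N : (0 < N)%N -> (N <= z)%N -> e * lnn N <= 2^-1.
  by move=> N0 Nz; rewrite -ez ler_wpM2l ?(ltW e0) // ler_lnn.
have half1 : 2^-1 <= 1 :> R by rewrite invf_le1 // ler1n.
have a0 p : ok p -> (p < z)%N -> 0 <= damped_inv e p.
  move=> /okP/prime_gt0 p0 /ltnW pz; apply: (damped_inv_ge0 (ltW e0) p0 (leqnn p)).
  by apply: le_trans half1; apply: le_ez.
have head l : l \in chains ok A k0 -> [/\ minn z (th l).+1 = (th l).+1,
    (th l < z)%N & lnn (\prod_(p <- l) p) - drift ok (damped_inv e) (th l).+1 <= -1].
  move=> lk; have v0 := prod_chains_gt0 okP lk.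
  have th0 : (0 < th l)%N by rewrite muln_gt0 A_gt0.
  have thz : (th l < z)%N.
    apply: leq_trans (_ : Th <= z)%N; last by rewrite /z; lia.
    by rewrite /Th; apply: (@leq_bigmax_seq _ _ xpredT (fun l => (th l).+1)).
  split=> //; first exact/minn_idPr.
  have eth : e * lnn (th l) <= 1 by apply: le_trans half1; apply: le_ez (ltnW thz).
  have := drift_ge okP (ltW e0) eth (mertK _ th0); rewrite -/(Q l).
  have eQ : e * Q l <= 2^-1.
    rewrite -ez ler_wpM2l ?(ltW e0) //; apply: le_trans (_ : lnn z1 <= _); last first.
      by rewrite ler_lnn // ?(ltnW z1_gt1) // leq_addl.
    apply: le_trans z1Q; rewrite (perm_big _ (perm_to_rem lk)) big_cons lerDl.
    by apply: sumr_ge0.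
  rewrite {1}/th lnn_mul //; move: AK eQ; lra.
have surv_ge0 N : (N <= z)%N -> 0 <= survival ok (damped_inv e) N.
  move=> Nz; rewrite /survival big_nat_cond; apply: prodr_ge0 => p /andP[/andP[_ pm] okp].
  by rewrite invr_ge0 addr_ge0 // a0 // (leq_trans pm).
have head_le0 l : l \in chains ok A k0 -> chain_term ok A (damped_inv e) z l <= 0.
  move=> lk; have [mE thz lel] := head l lk; rewrite /chain_term /= -/(th l) mE.
  apply: mulr_ge0_le0; last by apply: le_trans lel _; lra.
  rewrite mulr_ge0 ?surv_ge0 // big_seq; apply: prodr_ge0 => p /(mem_chains lk)[okp pk].
  by rewrite a0 // (leq_trans pk) // /z -addnA leq_addr.
have [s' k0E] := chains_cat ok A (leq0n k0).
have nil_in : [::] \in chains ok A k0 by rewrite k0E mem_head.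
have nil_le : chain_term ok A (damped_inv e) z [::] <= - c.
  have [mE thz lel] := head _ nil_in; rewrite /chain_term /= -/(th [::]) mE big_nil mul1r.
  have thE : th [::] = A by rewrite /th big_nil muln1.
  have c_le : c <= survival ok (damped_inv e) (th [::]).+1.
    rewrite thE in thz *; rewrite /c /survival big_nat_cond [leRHS]big_nat_cond.
    apply: ler_prod => p /andP[/andP[_ pA] okp].
    have ap : 0 <= damped_inv e p by apply: a0 => //; apply: leq_trans thz.
    rewrite invr_ge0 addr_ge0 ?invr_ge0 //= lef_pV2 ?posrE ?ltr_pwDl ?invr_ge0 //.
    by rewrite lerD2l damped_inv_le // ltW.
  move: c_le lel; set S := survival _ _ _; set d := _ - _; nra.
have [s zE] := chains_cat ok A (leq_addr (Th + z1) k0); rewrite addnA -/z in zE.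
have sum0 : \sum_(l <- chains ok A z) chain_term ok A (damped_inv e) z l = 0.
  apply: sum_chain_term => // p okp pz; have ap := a0 p okp pz.
  by rewrite gt_eqF // ltr_pwDl.
have head_sum : \sum_(l <- chains ok A k0) chain_term ok A (damped_inv e) z l <= - c.
  rewrite k0E big_cons -[leRHS]addr0; apply: lerD => //.
  rewrite big_seq; apply: sumr_le0 => l ls; apply: head_le0.
  by rewrite k0E inE ls orbT.
have tail_sum : \sum_(l <- s) chain_term ok A (damped_inv e) z l <= 2 * C1 * eta.
  apply: (@le_trans _ _ (\sum_(l <- s) 2 * C1 * (\prod_(p <- l) p)%:R^-1)).
    rewrite big_seq [leRHS]big_seq; apply: ler_sum => l ls.
    apply: (chain_term_le okP A_gt0 C10 e0 z_gt1 ez) => [N N1 eN|].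
      by apply: survC1 => //; apply: ltW.
    by rewrite zE mem_cat ls orbT.
  rewrite -mulr_sumr ler_wpM2l ?mulr_ge0 //.
  by have := k0P z; rewrite /U zE big_cat lerD2l.
move: sum0; rewrite zE big_cat /=; apply/eqP; rewrite lt_eqF //.
apply: le_lt_trans (lerD head_sum tail_sum) _.
rewrite addrC subr_lt0 /eta mulrA ltr_pdivrMr // mulrC ltr_pM2l //; lra.
Qed.

End Mertens.

(** * Practical multiples of an odd number, and the three cases *)

Lemma practical_divergent (b : nat) : odd b -> exists t, forall C : nat, exists E : seq nat,
  [/\ uniq E, forall d, d \in E -> [/\ odd d, (b %| d)%N & practical (2 ^ t * d)] &
     C%:R <= \sum_(d <- E) d%:R^-1 :> rat].
Proof.
move=> ob; have b0 := odd_gt0 ob.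
have b2 : (0 < 2 * b)%N by rewrite muln_gt0.
have [A0 A0P] := sum_chains_unbounded Rdefinitions.R b2.
pose t := (A0 + b).+1; have le_t : (A0 + b < 2 ^ t)%N by apply: ltnW; apply: ltn_expl.
pose N := (2 ^ t * b)%N.
have A0N : (A0 <= N)%N by rewrite /N; nia.
have NP : practical N by apply: practical_pow2_mul => //; lia.
set ok := fun p => prime p && ~~ (p %| 2 * b)%N in A0P.
have okP p : ok p -> prime p by case/andP.
have okN p : ok p -> prime p /\ ~~ (p %| N)%N.
  move=> /andP[pp p2b]; split=> //; apply: contra p2b.
  by rewrite /N !Euclid_dvdM // Euclid_dvdX // => /orP[/andP[-> _]//|->]; rewrite orbT.
(* The denominators are [b] times the chain products, which divides the reciprocal sum by [b]; hence
   the bound [C * b]. *)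
exists t => C; have [k leC] := A0P N A0N (C * b)%:R.
exists [seq (b * \prod_(p <- l) p)%N | l <- chains ok N k]; split.
- rewrite (map_comp (muln b) (fun l => \prod_(p <- l) p)%N) map_inj_uniq ?uniq_prod_chains //.
  by move=> m n /eqP; rewrite eqn_pmul2l // => /eqP.
- move=> d /mapP[l lk ->]; split; last by rewrite mulnA; apply: practical_chains lk.
    rewrite oddM ob big_seq; elim/big_rec: _ => //= p x /(mem_chains lk)[/andP[pp p2b] _] ox.
    rewrite oddM ox andbT; case: (even_prime pp) => // p2.
    by rewrite p2 dvdn_mulr in p2b.
  by rewrite dvdn_mulr.
rewrite big_map -(ler_rat Rdefinitions.R) ratr_nat rmorph_sum /=.
rewrite (eq_bigr (fun l => b%:R^-1 * (\prod_(p <- l) p)%:R^-1)) => [|l _]; last first.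
  by rewrite fmorphV rmorph_nat natrM invfM.
by rewrite -mulr_sumr ler_pdivlMl ?ltr0n // mulrC -natrM.
Qed.

Theorem corollary1 (q : rat) (hq : (0 < q)%R) :
  egyptian_in practical q /\ egyptian_in odious q /\ egyptian_in evil q.
Proof.
have parity s : egyptian_in (bit_parity s) q.
  apply: egyptian_in_of_divergent hq (@bit_parity_double s) _ => b ob.
  by exists 0%N; apply: bit_parity_divergent.
split; first exact: egyptian_in_of_divergent hq practical_double practical_divergent.
split; [have [D [DP qE]] := parity true | have [D [DP qE]] := parity false].
  by exists D.
by exists D; split=> // d /DP[d0 [_ /negbT dF]].
Qed.
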